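(* In the setting given in the context, for every $\kappa\in\mathcal{K}$, $$I(\kappa)=\max_{s\in\{-1,0,1\}^n}\ \max_{p\in\mathcal{R}_s(\kappa)}\left\{s^\top m^\bullet+\left(-R^\top s-\operatorname{diag}(\kappa)X^\top s\right)^\top p\right\},$$ where empty regions $\mathcal{R}_s(\kappa)$ are omitted.
   Context: Let $n\ge 1$, and let $R,X\in\mathbb{R}^{n\times n}$ be fixed matrices (active and reactive power voltage sensitivity matrices). Let $\underline{m},\overline{m},m^\bullet\in\mathbb{R}^n$ satisfy $\underline{m}\le 0\le\overline{m}$ and $\underline{m}\le m^\bullet\le\overline{m}$, and let $\underline{\alpha}\in\mathbb{R}^n$ with $0<\underline{\alpha}_i\le 1$ for all $i$. Vector inequalities are componentwise, and $\operatorname{sign}$ takes values in $\{-1,0,1\}$ with $\operatorname{sign}(0)=0$, applied componentwise to vectors. Let $\mathcal{P}\triangleq[0,1]^n$. For $\kappa\in\mathbb{R}^n$ set $\tilde S(\kappa)\triangleq R+X\operatorname{diag}(\kappa)$ and $\mathcal{P}(\kappa)\triangleq\prod_{i=1}^n\left[0,\frac{1}{\sqrt{1+\kappa_i^2}}\right]$. Define $$\mathcal{K}\triangleq\left\{\kappa\in\mathbb{R}^n:\ |\kappa_i|\le\frac{\sqrt{1-\underline{\alpha}_i^2}}{\underline{\alpha}_i}\ \forall i,\ \ \underline{m}\le\tilde S(\kappa)p'\le\overline{m}\ \ \forall p'\in\mathcal{P}\right\},$$ which is assumed nonempty. For $\kappa\in\mathcal{K}$ and $p\in\mathcal{P}(\kappa)$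 let $\tilde w(p,\kappa)\triangleq\|m^\bullet-\tilde S(\kappa)p\|_1$ and $I(\kappa)\triangleq\max_{p\in\mathcal{P}(\kappa)}\tilde w(p,\kappa)$. For $s\in\{-1,0,1\}^n$ and $\kappa\in\mathcal{K}$ let $\mathcal{R}_s(\kappa)\triangleq\{p\in\mathcal{P}(\kappa):\operatorname{sign}(m^\bullet-\tilde S(\kappa)p)=s\}$. For fixed $\kappa$ these regions form a disjoint partition of $\mathcal{P}(\kappa)$.
   Formalization: The inner maximum over a region R_s(κ) is read as a supremum, because regions need not be closed and that maximum may not exist; it is also proved that the supremum is finite, that I(κ) is attained, and that some region has an attained inner maximum equal to I(κ). *)

(* Defs.v *)
From HB Require Import structures.
From mathcomp Require Import all_boot all_order all_algebra.
From mathcomp Require Import all_classical all_reals.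

Set Implicit Arguments.
Unset Strict Implicit.
Unset Printing Implicit Defensive.

Import Order.TTheory GRing.Theory Num.Theory.
Local Open Scope classical_set_scope.
Local Open Scope ring_scope.

(* [is_max A x] reads "max A exists and equals x". *)
Definition is_max (R : realType) (A : set R) (x : R) : Prop :=
  A x /\ ubound A x.

Definition lev (R : realType) (n : nat) (u v : 'cV[R]_n) : Prop :=
  forall i, u i 0 <= v i 0.

Definition norm1 (R : realType) (n : nat) (v : 'cV[R]_n) : R :=
  \sum_i `|v i 0|.

(* [Num.sg] is the sign in {-1, 0, 1}, with [Num.sg 0 = 0]. *)
Definition signv (R : realType) (n : nat) (v : 'cV[R]_n) : 'cV[R]_n :=
  map_mx Num.sg v.

Definition sign_vectors (R : realType) (n : nat) : set 'cV[R]_n :=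
  [set s : 'cV[R]_n | forall i, [\/ s i 0 = -1, s i 0 = 0 | s i 0 = 1]].
Arguments sign_vectors : clear implicits.

Definition diagv (R : realType) (n : nat) (v : 'cV[R]_n) : 'M[R]_n :=
  diag_mx v^T.

Definition unit_cube (R : realType) (n : nat) : set 'cV[R]_n :=
  [set p : 'cV[R]_n | forall i, 0 <= p i 0 <= 1].
Arguments unit_cube : clear implicits.

Definition Stilde (R : realType) (n : nat) (Rm Xm : 'M[R]_n) (kappa : 'cV[R]_n)
  : 'M[R]_n := Rm + Xm *m diagv kappa.

Definition power_box (R : realType) (n : nat) (kappa : 'cV[R]_n)
  : set 'cV[R]_n :=
  [set p : 'cV[R]_n |
    forall i, 0 <= p i 0 <= 1 / Num.sqrt (1 + kappa i 0 ^+ 2)].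

(* The set K; [ml], [mu], [al] are the lower bound on m, the upper bound on m
   and the lower bound on alpha. *)
Definition feasible (R : realType) (n : nat) (Rm Xm : 'M[R]_n)
    (ml mu al : 'cV[R]_n) : set 'cV[R]_n :=
  [set kappa : 'cV[R]_n |
    (forall i, `|kappa i 0| <= Num.sqrt (1 - al i 0 ^+ 2) / al i 0) /\
    (forall p', unit_cube R n p' ->
       lev ml (Stilde Rm Xm kappa *m p') /\
       lev (Stilde Rm Xm kappa *m p') mu)].

Definition wtilde (R : realType) (n : nat) (Rm Xm : 'M[R]_n) (mb : 'cV[R]_n)
    (p kappa : 'cV[R]_n) : R :=
  norm1 (mb - Stilde Rm Xm kappa *m p).

(* [sup] is total; that this supremum is an attained maximum has to be
   asserted separately. *)
Definition worst_case (R : realType) (n : nat) (Rm Xm : 'M[R]_n)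
    (mb kappa : 'cV[R]_n) : R :=
  sup [set wtilde Rm Xm mb p kappa | p in power_box kappa].

Definition sign_region (R : realType) (n : nat) (Rm Xm : 'M[R]_n)
    (mb s kappa : 'cV[R]_n) : set 'cV[R]_n :=
  [set p : 'cV[R]_n |
    power_box kappa p /\ signv (mb - Stilde Rm Xm kappa *m p) = s].

Definition region_objective (R : realType) (n : nat) (Rm Xm : 'M[R]_n)
    (mb s kappa p : 'cV[R]_n) : R :=
  (s^T *m mb + (- (Rm^T *m s) - diagv kappa *m Xm^T *m s)^T *m p) 0 0.

Definition region_values (R : realType) (n : nat) (Rm Xm : 'M[R]_n)
    (mb s kappa : 'cV[R]_n) : set R :=
  [set region_objective Rm Xm mb s kappa p | p in sign_region Rm Xm mb s kappa].

(* The values of the maximisation over a single region, for the sign vectors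
   with a nonempty region. Regions are not closed in general and the maximum
   over a single region need not be attained (for R = [-1 0; 2 0], X = 0,
   m = (0, 2), kappa = 0 and s = (1, 1), the objective 2 - p_1 is maximised
   over 0 < p_1 < 1), hence the supremum here. *)
Definition region_maxima (R : realType) (n : nat) (Rm Xm : 'M[R]_n)
    (mb kappa : 'cV[R]_n) : set R :=
  [set sup (region_values Rm Xm mb s kappa) |
     s in [set s | sign_vectors R n s /\
                 sign_region Rm Xm mb s kappa !=set0]].

(* Main.v *)
Require Import Defs.
From mathcomp Require Import all_boot all_order all_algebra.
From mathcomp Require Import all_classical all_reals.

Import Order.TTheory GRing.Theory Num.Theory.
Local Open Scope classical_set_scope.
Local Open Scope ring_scope.

Set Implicit Arguments.
Unset Strict Implicit.
Unset Printing Implicit Defensive.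

(* On the region of s the deviation is s^T (m - S p), which is the objective of
   s. Hence every region value is at most I(kappa), and a maximiser of the
   deviation attains I(kappa) in the region of its own sign vector. A maximiser
   exists because the deviation at any point is dominated by the one at some of
   the finitely many vertices of the box. *)

Lemma is_max_sup (R : realType) (A : set R) (x : R) : is_max A x -> sup A = x.
Proof.
move=> [Ax ubx]; apply/eqP; rewrite eq_le; apply/andP; split.
  by apply: ge_sup => //; exists x.
by apply: ub_le_sup => //; exists x.
Qed.

(** Diagonal matrices are symmetric, so transposing [Stilde] turns [Xm *m diagv kappa] into
    [diagv kappa *m Xm^T]. *)
Lemma region_objectiveE (R : realType) (n : nat) (Rm Xm : 'M[R]_n)
    (mb s kappa p : 'cV[R]_n) :
  region_objective Rm Xm mb s kappa p =
  (s^T *m (mb - Stilde Rm Xm kappa *m p)) 0 0.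
Proof.
rewrite /region_objective /Stilde; congr (fun_of_matrix _ _ _).
rewrite mulmxBr; congr (_ + _).
rewrite -opprD linearN /= mulNmx; congr (- _).
rewrite linearD /= !trmx_mul !trmxK /diagv tr_diag_mx.
by rewrite [in RHS]mulmxDl [in RHS]mulmxDr [in LHS]mulmxDl !mulmxA.
Qed.

Lemma dot_sg (R : realType) (n : nat) (v : 'cV[R]_n) :
  ((signv v)^T *m v) 0 0 = norm1 v.
Proof.
by rewrite mxE; apply: eq_bigr => i _; rewrite !mxE -normrEsg.
Qed.

Lemma dot_le_norm1 (R : realType) (n : nat) (s v : 'cV[R]_n) :
  sign_vectors R n s -> (s^T *m v) 0 0 <= norm1 v.
Proof.
move=> sP; rewrite mxE; apply: ler_sum => i _; rewrite mxE.
case: (sP i) => ->; rewrite ?(mulN1r, mul0r, mul1r) ?ler_norm //.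
by rewrite -normrN ler_norm.
Qed.

Lemma sign_vectors_signv (R : realType) (n : nat) (v : 'cV[R]_n) :
  sign_vectors R n (signv v).
Proof.
by move=> i; rewrite mxE; case: sgrP => _;
  [apply: Or32 | apply: Or33 | apply: Or31].
Qed.

Lemma region_objective_sign_region (R : realType) (n : nat) (Rm Xm : 'M[R]_n)
    (mb s kappa p : 'cV[R]_n) :
  sign_region Rm Xm mb s kappa p ->
  region_objective Rm Xm mb s kappa p = wtilde Rm Xm mb p kappa.
Proof. by move=> [_ <-]; rewrite region_objectiveE dot_sg. Qed.

(** Indexing the vertices by subsets makes them a finite family, over which a maximum exists without
    a compactness argument. *)
Definition box_vertex (R : realType) (n : nat) (kappa : 'cV[R]_n)
    (A : {set 'I_n}) : 'cV[R]_n :=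
  \col_i if i \in A then 1 / Num.sqrt (1 + kappa i 0 ^+ 2) else 0.

Lemma power_box_vertex (R : realType) (n : nat) (kappa : 'cV[R]_n)
    (A : {set 'I_n}) : power_box kappa (box_vertex kappa A).
Proof.
have b_ge0 i : 0 <= 1 / Num.sqrt (1 + kappa i 0 ^+ 2).
  by rewrite divr_ge0 ?sqrtr_ge0.
by move=> i; rewrite mxE; case: ifP => _; rewrite lexx b_ge0.
Qed.

(** A linear form on a box is maximised coordinatewise: at the upper end where its coefficient is
    nonnegative, at 0 elsewhere. *)
Lemma dot_le_vertex (R : realType) (n : nat) (kappa c p : 'cV[R]_n) :
  power_box kappa p ->
  (c^T *m p) 0 0 <= (c^T *m box_vertex kappa [set i | 0 <= c i 0]%SET) 0 0.
Proof.
move=> pP; rewrite !mxE; apply: ler_sum => i _; rewrite !mxE inE.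
have /andP[p0 pb] := pP i.
case: ifPn => [c0|]; first exact: ler_wpM2l.
by rewrite -ltNge mulr0 => /ltW c0; rewrite mulr_le0_ge0.
Qed.

(* With s the sign vector at p, the deviation at p equals the objective of s;
   that affine function grows when p moves to a suitable vertex, where it is
   still at most the deviation. *)
Lemma wtilde_le_vertex (R : realType) (n : nat) (Rm Xm : 'M[R]_n)
    (mb kappa p : 'cV[R]_n) : power_box kappa p ->
  exists A, wtilde Rm Xm mb p kappa <=
            wtilde Rm Xm mb (box_vertex kappa A) kappa.
Proof.
move=> pP; pose s := signv (mb - Stilde Rm Xm kappa *m p).
have pR : sign_region Rm Xm mb s kappa p by [].
pose c := - (Rm^T *m s) - diagv kappa *m Xm^T *m s.
exists [set i | 0 <= c i 0]%SET.
apply: (@le_trans _ _ (region_objective Rm Xm mb s kappa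
  (box_vertex kappa [set i | 0 <= c i 0]%SET))).
  rewrite -(region_objective_sign_region pR) /region_objective -/c.
  by rewrite [leLHS]mxE [leRHS]mxE lerD2l dot_le_vertex.
by rewrite region_objectiveE dot_le_norm1 //; apply: sign_vectors_signv.
Qed.

Lemma wtilde_attains_max (R : realType) (n : nat) (Rm Xm : 'M[R]_n)
    (mb kappa : 'cV[R]_n) :
  exists2 q, power_box kappa q & forall p, power_box kappa p ->
    wtilde Rm Xm mb p kappa <= wtilde Rm Xm mb q kappa.
Proof.
pose f A := wtilde Rm Xm mb (box_vertex kappa A) kappa.
(* The empty subset only shows that the family of candidates is inhabited. *)
case: (arg_maxP f (isT : xpredT (finset.set0 : {set 'I_n}))) => A _ maxA.
exists (box_vertex kappa A); first exact: power_box_vertex.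
move=> p /(wtilde_le_vertex Rm Xm mb)[B /le_trans]; apply.
exact: maxA.
Qed.

(* MathComp / MathComp-Analysis *)
Theorem proposition1 (R : realType) (n : nat) (hn : (1 <= n)%N)
    (Rm Xm : 'M[R]_n) (ml mu mb al : 'cV[R]_n)
    (hml : lev ml 0) (hmu : lev 0 mu)
    (hmlb : lev ml mb) (hmbu : lev mb mu)
    (hal : forall i, 0 < al i 0 <= 1)
    (hK : feasible Rm Xm ml mu al !=set0)
    (kappa : 'cV[R]_n) (hkappa : feasible Rm Xm ml mu al kappa) :
  [/\ (* I(kappa) is a maximum *)
      is_max [set wtilde Rm Xm mb p kappa | p in power_box kappa]
        (worst_case Rm Xm mb kappa),
      (* the inner problem over each nonempty region has a finite value *)
      forall s, sign_vectors R n s -> sign_region Rm Xm mb s kappa !=set0 ->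
        has_sup (region_values Rm Xm mb s kappa),
      (* I(kappa) is the maximum of these values over the nonempty regions *)
      is_max (region_maxima Rm Xm mb kappa) (worst_case Rm Xm mb kappa) &
      (* for some region the inner maximum is attained and equals I(kappa) *)
      exists2 s, sign_vectors R n s &
        is_max (region_values Rm Xm mb s kappa) (worst_case Rm Xm mb kappa)].
Proof.
have [q qP qmax] := wtilde_attains_max Rm Xm mb kappa.
pose M := wtilde Rm Xm mb q kappa.
have maxM : is_max [set wtilde Rm Xm mb p kappa | p in power_box kappa] M.
  by split; [exists q | move=> _ [p pP <-]; apply: qmax].
have -> : worst_case Rm Xm mb kappa = M by apply: is_max_sup.
have ubM s : ubound (region_values Rm Xm mb s kappa) M.
  move=> _ [p pR <-]; rewrite (region_objective_sign_region pR).
  by apply: qmax; case: pR.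
pose s := signv (mb - Stilde Rm Xm kappa *m q).
have qR : sign_region Rm Xm mb s kappa q by [].
have sP : sign_vectors R n s by apply: sign_vectors_signv.
have maxs : is_max (region_values Rm Xm mb s kappa) M.
  by split=> //; exists q => //; apply: region_objective_sign_region.
split=> //; last by exists s.
- move=> t _ [p pR]; split; last by exists M.
  by exists (region_objective Rm Xm mb t kappa p); exists p.
- split; first by exists s; [split=> //; exists q | apply: is_max_sup].
  (* In a region where the supremum may not be attained, the bound [M] still passes to it; the point
     [p] makes the set of values nonempty. *)
  move=> _ [t [_ [p pR]] <-]; apply: ge_sup => //.
  by exists (region_objective Rm Xm mb t kappa p); exists p.
Qed.
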